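(* Let $F,G$ be non-constant real functions of one real variable and let $$w(x,y)=2\,\mathrm{arctanh}\bigl(F(x)G(y)\bigr),$$ not identically zero, be a solution of the sinh-Gordon equation $\Delta w=2\sinh(2w)$ on an open simply connected set $\Omega\subset\mathbb{R}^2$, where $F$ and $G$ are defined on the projections of $\Omega$ to the $x$-axis and to the $y$-axis respectively. Then there are constants $A,B,C$ such that \begin{align*} (F'(x))^2&=A\,F^4(x)+B\,F^2(x)+C,\\ (G'(y))^2&=-C\,G^4(y)-(B-4)\,G^2(y)-A . \end{align*}
   Context: $\Delta=\partial_{xx}^2+\partial_{yy}^2$ is the flat Laplacian; solutions $w$ are real-valued and $C^2$, so in particular $|F(x)G(y)|<1$ on $\Omega$. *)

(* Defs.v *)
From Stdlib Require Import Reals Lra.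
From Coquelicot Require Import Coquelicot.
Open Scope R_scope.

(* The inverse of tanh : R -> ]-1,1[; only meaningful for -1 < u < 1. *)
Definition arctanh (u : R) : R := / 2 * ln ((1 + u) / (1 - u)).

Lemma tanh_arctanh (u : R) : -1 < u < 1 -> tanh (arctanh u) = u.
Proof.
intros Hu.
assert (Hq : 0 < (1 + u) / (1 - u)) by (apply Rdiv_lt_0_compat; lra).
set (a := arctanh u).
assert (Ha : exp a * exp a = (1 + u) / (1 - u)).
{ rewrite <- exp_plus; unfold a, arctanh.
  replace (_ + _) with (ln ((1 + u) / (1 - u))) by field.
  now apply exp_ln. }
unfold tanh, sinh, cosh; rewrite exp_Ropp.
assert (He := exp_pos a).
replace ((exp a - / exp a) / 2 / ((exp a + / exp a) / 2))
  with ((exp a * exp a - 1) / (exp a * exp a + 1))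
  by (field; split; nra).
rewrite Ha; field; lra.
Qed.

Definition unit_interval (t : R) : Prop := 0 <= t <= 1.

Definition unit_square (p : R * R) : Prop :=
  unit_interval (fst p) /\ unit_interval (snd p).

(* Only the values of g on [0,1] matter. *)
Definition path_in (D : R * R -> Prop) (p q : R * R) (g : R -> R * R) : Prop :=
  continuous_on unit_interval g /\
  (forall t, unit_interval t -> D (g t)) /\ g 0 = p /\ g 1 = q.

Definition path_connected (D : R * R -> Prop) : Prop :=
  forall p q, D p -> D q -> exists g, path_in D p q g.

(* Homotopy, relative to the base point p and inside D, from the loop g to the
   constant loop; the first coordinate is the loop parameter and the second
   one the deformation parameter. *)
Definition null_homotopic (D : R * R -> Prop) (p : R * R) (g : R -> R * R) : Prop :=
  exists H : R * R -> R * R,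
    continuous_on unit_square H /\
    (forall z, unit_square z -> D (H z)) /\
    (forall t, unit_interval t -> H (t, 0) = g t) /\
    (forall t, unit_interval t -> H (t, 1) = p) /\
    (forall s, unit_interval s -> H (0, s) = p /\ H (1, s) = p).

Definition simply_connected (D : R * R -> Prop) : Prop :=
  path_connected D /\
  forall p g, path_in D p p g -> null_homotopic D p g.

Definition proj_x (D : R * R -> Prop) (x : R) : Prop := exists y, D (x, y).
Definition proj_y (D : R * R -> Prop) (y : R) : Prop := exists x, D (x, y).

Definition non_constant_on (I : R -> Prop) (f : R -> R) : Prop :=
  exists s t, I s /\ I t /\ f s <> f t.

(* On an open set D this is the usual notion: [ex_diff_n w 2] asks for the
   existence of all partial derivatives of order at most 2 and for their
   joint continuity at the given point. *)
Definition C2_on (D : R * R -> Prop) (w : R -> R -> R) : Prop :=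
  forall x y, D (x, y) -> ex_diff_n w 2 x y.

Definition Laplacian (w : R -> R -> R) (x y : R) : R :=
  Derive_n (fun t => w t y) 2 x + Derive_n (fun t => w x t) 2 y.

Definition sinh_Gordon_solution (D : R * R -> Prop) (w : R -> R -> R) : Prop :=
  C2_on D w /\
  forall x y, D (x, y) -> Laplacian w x y = 2 * sinh (2 * w x y).

(* Main.v *)
Require Import Defs.
From Stdlib Require Import Reals Lra Classical ClassicalEpsilon.
From Coquelicot Require Import Coquelicot.
Open Scope R_scope.

(** With u = F(x) G(y) the sinh-Gordon equation for w = 2 arctanh u becomes the
    polynomial identity

      (1 - F^2 G^2) (F'' G + F G'') + 2 F G (F'^2 G^2 + F^2 G'^2)
        = 4 F G (1 + F^2 G^2),

    which, read as a sum of products of a function of x and a function of y, is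

      F'' G + F (G'' - 4 G) + G^3 (2 F F'^2 - F^2 F'')
        + F^3 (2 G G'^2 - G^2 G'' - 4 G^3) = 0.

    Two values of y at which G takes non-zero values with distinct squares allow
    the elimination of the third product, so F'' is a linear combination of F
    and F^3, say F'' = 2 A F^3 + B F; then F'^2 - A F^4 - B F^2 is a first
    integral, with value C.  Substituting back and using two values of x gives
    the equation for G with the announced coefficients
    ([local_quartic_equations]).  All this takes place on a square contained in
    the domain, and requires that neither factor be constant there.

    The remaining difficulty is the passage from squares to the whole domain.
    At a fixed y with G(y) <> 0 the identity is a second order ordinary
    differential equation for F, and it is regular because |F G| < 1.  If F
    equals a constant c near a point then c solves this equation, and a Gronwall
    argument shows that F = c on the side of the whole square
    ([constant_near_constant]).  By connectedness ([identity_principle]) this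
    gives in turn: F and G vanish identically on no square, since w is not zero;
    F and G are constant on no square, since they are not constant globally; the
    coefficients A, B, C are the same everywhere, since two squares that meet
    share an open set on which F takes enough values to determine them. *)

(** * Open intervals and squares *)

Definition twice_derivable_at (f : R -> R) (x : R) : Prop :=
  ex_derive f x /\ ex_derive (Derive f) x.

Lemma ball_R_iff (x0 r x : R) : ball x0 r x <-> Rabs (x - x0) < r.
Proof. reflexivity. Qed.

Lemma ball_R_convex (x0 r a b t : R) :
  ball x0 r a -> ball x0 r b -> Rmin a b <= t <= Rmax a b -> ball x0 r t.
Proof.
rewrite !ball_R_iff; intros Ha Hb Ht.
apply Rabs_def2 in Ha; apply Rabs_def2 in Hb.
apply Rabs_def1; revert Ht; unfold Rmin, Rmax; destruct (Rle_dec a b); lra.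
Qed.

Lemma ball_R_open (x0 r q : R) : ball x0 r q -> locally q (ball x0 r).
Proof.
intros Hq; rewrite ball_R_iff in Hq.
assert (H : 0 < r - Rabs (q - x0)) by lra.
exists (mkposreal _ H); intros z Hz; rewrite ball_R_iff in Hz |- *; simpl in Hz.
replace (z - x0) with ((z - q) + (q - x0)) by ring.
generalize (Rabs_triang (z - q) (q - x0)); lra.
Qed.

Lemma ball_R2_open (p q : R * R) (r : R) : ball p r q -> locally q (ball p r).
Proof.
intros [H1 H2].
destruct (ball_R_open _ _ _ H1) as [e1 He1].
destruct (ball_R_open _ _ _ H2) as [e2 He2].
assert (H : 0 < Rmin e1 e2) by (apply Rmin_glb_lt; apply cond_pos).
exists (mkposreal _ H); intros z [Hz1 Hz2]; simpl in Hz1, Hz2; split.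
- apply He1; apply ball_le with (2 := Hz1); apply Rmin_l.
- apply He2; apply ball_le with (2 := Hz2); apply Rmin_r.
Qed.

(** * Uniqueness for linear second order equations *)

Lemma Derive_locally_constant (f : R -> R) (c x : R) :
  locally x (fun t => f t = c) -> Derive f x = 0.
Proof.
intros H; rewrite (Derive_ext_loc f (fun _ => c)) by exact H.
apply Derive_const.
Qed.

(** Gronwall: the energy E = H^2 + H'^2 satisfies |E'| <= K E on the segment,
    hence E exp (k t) is monotone for k = K and for k = -K, and the choice of
    sign depends on the side of x1 on which x2 lies. *)
Lemma linear_ode_zero (H a b : R -> R) (x1 x2 : R) :
  (forall t, Rmin x1 x2 <= t <= Rmax x1 x2 ->
     twice_derivable_at H t /\ continuous a t /\ continuous b t /\
     Derive (Derive H) t = a t * H t + b t * Derive H t) ->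
  H x1 = 0 -> Derive H x1 = 0 -> H x2 = 0.
Proof.
intros Hode H0 H1.
assert (Hm : exists M, forall t, Rmin x1 x2 <= t <= Rmax x1 x2 ->
  Rabs (a t) <= M /\ Rabs (b t) <= M).
{ destruct (bounded_continuity a (Rmin x1 x2) (Rmax x1 x2)) as [Ma HMa].
  { intros t Ht; apply (Hode t Ht). }
  destruct (bounded_continuity b (Rmin x1 x2) (Rmax x1 x2)) as [Mb HMb].
  { intros t Ht; apply (Hode t Ht). }
  exists (Rmax Ma Mb); intros t Ht; split.
  - apply Rle_trans with (2 := Rmax_l _ _); apply Rlt_le, (HMa t Ht).
  - apply Rle_trans with (2 := Rmax_r _ _); apply Rlt_le, (HMb t Ht). }
destruct Hm as [M HM].
set (E := fun t => H t ^ 2 + Derive H t ^ 2).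
set (E' := fun t => 2 * H t * Derive H t + 2 * Derive H t * Derive (Derive H) t).
assert (HE : forall t, Rmin x1 x2 <= t <= Rmax x1 x2 -> is_derive E t (E' t)).
{ intros t Ht; destruct (Hode t Ht) as [[d1 d2] _].
  unfold E, E'; auto_derive; [now repeat split|].
  change (Derive (fun x : R => Derive (fun x0 : R => H x0) x) t)
    with (Derive (Derive H) t).
  change (Derive (fun x : R => H x) t) with (Derive H t).
  change (Derive (fun x : R => Derive H x) t) with (Derive (Derive H) t).
  ring. }
assert (Hb : forall t, Rmin x1 x2 <= t <= Rmax x1 x2 ->
  Rabs (E' t) <= (1 + 3 * M) * E t).
{ intros t Ht; destruct (HM t Ht) as [Ha Hb].
  destruct (Hode t Ht) as (_ & _ & _ & Eq).
  unfold E', E; rewrite Eq.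
  set (h := H t) in *; set (k := Derive H t) in *.
  replace (_ + _) with ((1 + a t) * (2 * h * k) + b t * (2 * k ^ 2)) by ring.
  assert (Hhk : Rabs (2 * h * k) <= h ^ 2 + k ^ 2).
  { generalize (pow2_ge_0 (h + k)) (pow2_ge_0 (h - k)); intros.
    apply Rabs_le; lra. }
  assert (Hkk : Rabs (2 * k ^ 2) <= 2 * (h ^ 2 + k ^ 2)).
  { generalize (pow2_ge_0 h) (pow2_ge_0 k); intros.
    apply Rabs_le; lra. }
  assert (H1a : Rabs (1 + a t) <= 1 + M).
  { generalize (Rabs_triang 1 (a t)); rewrite Rabs_R1; lra. }
  eapply Rle_trans; [apply Rabs_triang|rewrite !Rabs_mult].
  replace ((1 + 3 * M) * (h ^ 2 + k ^ 2))
    with ((1 + M) * (h ^ 2 + k ^ 2) + M * (2 * (h ^ 2 + k ^ 2))) by ring.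
  rewrite <- !Rabs_mult, (Rabs_mult (1 + a t)), (Rabs_mult (b t)).
  apply Rplus_le_compat; apply Rmult_le_compat; auto; apply Rabs_pos. }
(* E exp (- k t) does not increase from x1 towards x2. *)
assert (Hk : exists k, forall t, Rmin x1 x2 <= t <= Rmax x1 x2 ->
  (E' t - k * E t) * (x2 - x1) <= 0).
{ destruct (Rle_dec x1 x2) as [Hx|Hx].
  - exists (1 + 3 * M); intros t Ht; specialize (Hb t Ht).
    apply Rabs_le_between in Hb; nra.
  - exists (- (1 + 3 * M)); intros t Ht; specialize (Hb t Ht).
    apply Rabs_le_between in Hb; nra. }
destruct Hk as [k Hk].
set (W := fun t => E t * exp (- k * t)).
assert (HW : forall t, Rmin x1 x2 <= t <= Rmax x1 x2 ->
  is_derive W t ((E' t - k * E t) * exp (- k * t))).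
{ intros t Ht; specialize (HE t Ht).
  unfold W; auto_derive; [now exists (E' t)|].
  replace (Derive _ t) with (E' t) by (symmetry; now apply is_derive_unique).
  ring. }
destruct (MVT_gen W x1 x2 (fun t => (E' t - k * E t) * exp (- k * t)))
  as [t [Ht Eq]].
- intros t Ht; apply HW; lra.
- intros t Ht; apply continuity_pt_filterlim.
  apply (ex_derive_continuous W); eexists; apply (HW t Ht).
- assert (W x1 = 0) by (unfold W, E; rewrite H0, H1; ring).
  assert (HW2 : W x2 <= 0).
  { replace (W x2) with (W x2 - W x1) by lra; rewrite Eq.
    replace (_ * _) with (((E' t - k * E t) * (x2 - x1)) * exp (- k * t)) by ring.
    generalize (Hk t Ht) (exp_pos (- k * t)); nra. }
  unfold W in HW2; generalize (exp_pos (- k * x2)); intros Hp.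
  assert (HE2 : E x2 <= 0) by nra.
  unfold E in HE2; nra.
Qed.

Lemma constant_of_derive_zero (f : R -> R) (x0 r : R) :
  (forall x, ball x0 r x -> is_derive f x 0) ->
  forall a b, ball x0 r a -> ball x0 r b -> f a = f b.
Proof.
intros Hf a b Ha Hb.
destruct (MVT_gen f a b (fun _ => 0)) as [t [_ Eq]].
- intros t Ht; apply Hf, (ball_R_convex x0 r a b); auto; lra.
- intros t Ht; apply continuity_pt_filterlim.
  apply (ex_derive_continuous f); exists 0.
  now apply Hf, (ball_R_convex x0 r a b).
- lra.
Qed.

(** * The separated equation on a square *)

(** The equation Laplacian w = 2 sinh (2 w) for w = 2 arctanh (f g), multiplied
    by (1 - f^2 g^2)^2 / 2; the indices 1 and 2 stand for first and second
    derivatives. *)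
Definition separated_equation (f f1 f2 g g1 g2 : R) : Prop :=
  (1 - f ^ 2 * g ^ 2) * (f2 * g + f * g2)
    + 2 * f * g * (f1 ^ 2 * g ^ 2 + f ^ 2 * g1 ^ 2)
  = 4 * f * g * (1 + f ^ 2 * g ^ 2).

Lemma separated_equation_sym (f f1 f2 g g1 g2 : R) :
  separated_equation f f1 f2 g g1 g2 -> separated_equation g g1 g2 f f1 f2.
Proof.
unfold separated_equation; intros H.
replace (4 * g * f * (1 + g ^ 2 * f ^ 2))
  with (4 * f * g * (1 + f ^ 2 * g ^ 2)) by ring.
rewrite <- H; ring.
Qed.

(** At fixed y the separated equation has the form

      g (1 - g^2 F^2) F'' + 2 g^3 F F'^2 + P(F) = 0,  P(f) = k f + m f^3.

    If F = c near q then P(c) = 0, so P(F) is a multiple of F - c and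
    H = F - c solves a linear homogeneous equation with continuous coefficients,
    the leading one being non-zero because |F g| < 1. *)
Lemma constant_near_constant (F : R -> R) (x0 r g g1 g2 c q : R) :
  (forall x, ball x0 r x ->
     twice_derivable_at F x /\ Rabs (F x * g) < 1 /\
     separated_equation (F x) (Derive F x) (Derive (Derive F) x) g g1 g2) ->
  g <> 0 -> ball x0 r q -> locally q (fun x => F x = c) ->
  forall x, ball x0 r x -> F x = c.
Proof.
intros HF Hg Hq Hc x Hx.
assert (Hc1 : Derive F q = 0) by (now apply Derive_locally_constant with c).
assert (Hc2 : Derive (Derive F) q = 0).
{ apply Derive_locally_constant with 0.
  apply locally_locally in Hc; revert Hc; apply filter_imp; intros t Ht.
  now apply Derive_locally_constant with c. }
assert (Hcq : F q = c) by exact (locally_singleton _ _ Hc).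
set (k := g2 - 4 * g).
set (m := 2 * g * g1 ^ 2 - g ^ 2 * g2 - 4 * g ^ 3).
assert (Hkm : c * (k + m * c ^ 2) = 0).
{ destruct (HF q Hq) as (_ & _ & Eq).
  unfold separated_equation in Eq; rewrite Hc1, Hc2, Hcq in Eq.
  unfold k, m; nra. }
assert (HD : forall t, ball x0 r t -> (1 - g ^ 2 * F t ^ 2) * g <> 0).
{ intros t Ht; destruct (HF t Ht) as (_ & Hl & _).
  apply Rmult_integral_contrapositive_currified; [|exact Hg].
  apply Rabs_def2 in Hl; nra. }
set (H := fun t => F t - c).
assert (HDe : forall t, ball x0 r t -> is_derive H t (Derive F t)).
{ intros t Ht; destruct (HF t Ht) as [[d1 _] _].
  unfold H; auto_derive; [exact d1|].
  change (Derive (fun x1 : R => F x1) t) with (Derive F t); ring. }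
assert (HDe2 : forall t, ball x0 r t ->
  locally t (fun t => Derive F t = Derive H t)).
{ intros t Ht; generalize (ball_R_open _ _ _ Ht); apply filter_imp.
  intros s Hs; symmetry; now apply is_derive_unique, HDe. }
cut (H x = 0); [unfold H; lra|].
apply (linear_ode_zero H
  (fun t => - (k + m * (F t ^ 2 + F t * c + c ^ 2)) / ((1 - g ^ 2 * F t ^ 2) * g))
  (fun t => - (2 * g ^ 3 * F t * Derive F t) / ((1 - g ^ 2 * F t ^ 2) * g)) q x).
- intros t Hseg; assert (Ht := ball_R_convex _ _ _ _ _ Hq Hx Hseg).
  specialize (HD t Ht); destruct (HF t Ht) as ((d1 & d2) & _ & Eq).
  split; [split|split; [|split]].
  + eexists; now apply HDe.
  + now apply ex_derive_ext_loc with (Derive F); [apply HDe2|].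
  + apply (ex_derive_continuous (V := R_NormedModule)).
    auto_derive; repeat split; trivial; intros Z; apply HD; rewrite <- Z; ring.
  + apply (ex_derive_continuous (V := R_NormedModule)).
    auto_derive; repeat split; trivial; intros Z; apply HD; rewrite <- Z; ring.
  + rewrite <- (Derive_ext_loc _ _ _ (HDe2 t Ht)).
    rewrite (is_derive_unique _ _ _ (HDe t Ht)).
    apply Rmult_eq_reg_l with (2 := HD).
    unfold separated_equation in Eq.
    transitivity (- (k + m * (F t ^ 2 + F t * c + c ^ 2)) * (F t - c)
                  - 2 * g ^ 3 * F t * Derive F t * Derive F t).
    * transitivity (- (k * F t + m * F t ^ 3) + c * (k + m * c ^ 2)
        - 2 * g ^ 3 * F t * Derive F t ^ 2); [|ring].
      rewrite Hkm; unfold k, m; lra.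
    * unfold H; field; split; [exact Hg|].
      intros Z; apply HD; transitivity ((1 - (g * F t) ^ 2) * g); [ring|].
      rewrite Z; ring.
- unfold H; rewrite Hcq; ring.
- rewrite (is_derive_unique _ _ _ (HDe q Hq)); exact Hc1.
Qed.

Lemma first_integral (F : R -> R) (x0 r A B : R) :
  (forall x, ball x0 r x ->
     twice_derivable_at F x /\
     Derive (Derive F) x = 2 * A * F x ^ 3 + B * F x) ->
  exists C, forall x, ball x0 r x ->
    Derive F x ^ 2 = A * F x ^ 4 + B * F x ^ 2 + C.
Proof.
intros HF.
set (E := fun x => Derive F x ^ 2 - A * F x ^ 4 - B * F x ^ 2).
assert (HE : forall x, ball x0 r x -> is_derive E x 0).
{ intros x Hx; destruct (HF x Hx) as [[d1 d2] Eq].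
  unfold E; auto_derive; [now repeat split|].
  change (Derive (fun x : R => F x) x) with (Derive F x).
  change (Derive (fun x : R => Derive (fun x0 : R => F x0) x) x)
    with (Derive (Derive F) x).
  change (Derive (fun x : R => Derive F x) x) with (Derive (Derive F) x).
  rewrite Eq; ring. }
exists (E x0); intros x Hx.
rewrite <- (constant_of_derive_zero E x0 r HE x x0 Hx).
- unfold E; ring.
- rewrite ball_R_iff in Hx |- *. rewrite Rminus_eq_0, Rabs_R0.
  generalize (Rabs_pos (x - x0)); lra.
Qed.

(** If all non-zero values of F had the same square k, then F (F^2 - k) = 0
    throughout; differentiating gives (3 F^2 - k) F' = 0, where 3 F^2 - k is
    - k or 2 k and thus non-zero, so that F would be constant. *)
Lemma two_distinct_squares (F : R -> R) (x0 r a b : R) :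
  (forall x, ball x0 r x -> ex_derive F x) ->
  ball x0 r a -> ball x0 r b -> F a <> F b ->
  exists x1 x2, ball x0 r x1 /\ ball x0 r x2 /\
    F x1 * F x2 * (F x2 ^ 2 - F x1 ^ 2) <> 0.
Proof.
intros HF Ha Hb Hab.
apply Classical_Prop.NNPP; intros Hno.
assert (Hz : forall x1 x2, ball x0 r x1 -> ball x0 r x2 ->
  F x1 * F x2 * (F x2 ^ 2 - F x1 ^ 2) = 0).
{ intros x1 x2 H1 H2; apply Classical_Prop.NNPP; intros H; apply Hno.
  now exists x1, x2. }
assert (H0 : exists x1, ball x0 r x1 /\ F x1 <> 0).
{ destruct (Req_dec (F a) 0) as [Fa|Fa]; [exists b|exists a]; split; trivial.
  intros Fb; apply Hab; lra. }
destruct H0 as [x1 [Hx1 F1]].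
set (k := F x1 ^ 2) in *.
assert (Hk : k <> 0) by (apply pow_nonzero; exact F1).
assert (Hcub : forall x, ball x0 r x -> F x ^ 3 - k * F x = 0).
{ intros x Hx; apply Rmult_eq_reg_l with (2 := F1).
  rewrite Rmult_0_r, <- (Hz x1 x Hx1 Hx); unfold k; ring. }
apply Hab, (constant_of_derive_zero F x0 r); trivial.
intros x Hx.
assert (HD : (3 * F x ^ 2 - k) * Derive F x = 0).
{ transitivity (Derive (fun x => F x ^ 3 - k * F x) x).
  - symmetry; apply is_derive_unique; auto_derive; [now repeat split; apply HF|].
    change (Derive (fun x : R => F x) x) with (Derive F x); ring.
  - apply Derive_locally_constant with 0.
    generalize (ball_R_open _ _ _ Hx); apply filter_imp; exact Hcub. }
assert (HD0 : Derive F x = 0).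
{ assert (Hc := Hcub x Hx).
  assert (F x * (F x ^ 2 - k) = 0) by (rewrite <- Hc; ring).
  apply Rmult_integral in HD; destruct HD as [HD|HD]; [exfalso|exact HD].
  apply Rmult_integral in H; destruct H as [H|H]; [|nra].
  rewrite H in HD; nra. }
rewrite <- HD0; apply Derive_correct, HF, Hx.
Qed.

(** The elimination.  D below is the determinant of the system in the two
    unknowns F'' and 2 F F'^2 - F^2 F'' given by y = y1 and y = y2.  Once F''
    and F'^2 are known, the equation reads F (U + F^2 V) = 0 with U and V
    depending on y only; two values of x give U = 0, which is the second order
    equation for G, and V = 0, which fixes its constant of integration. *)
Lemma local_quartic_equations (F G : R -> R) (x0 y0 r : R) :
  (forall x, ball x0 r x -> twice_derivable_at F x) ->
  (forall y, ball y0 r y -> twice_derivable_at G y) ->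
  (forall x y, ball x0 r x -> ball y0 r y ->
     separated_equation (F x) (Derive F x) (Derive (Derive F) x)
                        (G y) (Derive G y) (Derive (Derive G) y)) ->
  (exists a b, ball x0 r a /\ ball x0 r b /\ F a <> F b) ->
  (exists a b, ball y0 r a /\ ball y0 r b /\ G a <> G b) ->
  exists A B C : R,
    (forall x, ball x0 r x ->
       Derive (Derive F) x = 2 * A * F x ^ 3 + B * F x /\
       Derive F x ^ 2 = A * F x ^ 4 + B * F x ^ 2 + C) /\
    (forall y, ball y0 r y ->
       Derive G y ^ 2 = - C * G y ^ 4 - (B - 4) * G y ^ 2 - A).
Proof.
intros dF dG Hsep (a & b & Ha & Hb & Fab) (c & d & Hc & Hd & Gcd).
destruct (two_distinct_squares F x0 r a b) as (x1 & x2 & Hx1 & Hx2 & Fx);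
  trivial; [intros; now apply dF|].
destruct (two_distinct_squares G y0 r c d) as (y1 & y2 & Hy1 & Hy2 & Gy);
  trivial; [intros; now apply dG|].
(* The equation is F'' G + F k + G^3 (2 F F'^2 - F^2 F'') + F^3 m = 0. *)
set (k := fun y => Derive (Derive G) y - 4 * G y).
set (m := fun y => 2 * G y * Derive G y ^ 2 - G y ^ 2 * Derive (Derive G) y
                   - 4 * G y ^ 3).
set (D := G y1 * G y2 * (G y2 ^ 2 - G y1 ^ 2)) in *.
set (B := - (k y1 * G y2 ^ 3 - k y2 * G y1 ^ 3) / D).
set (A := - (m y1 * G y2 ^ 3 - m y2 * G y1 ^ 3) / (2 * D)).
assert (HF2 : forall x, ball x0 r x ->
  Derive (Derive F) x = 2 * A * F x ^ 3 + B * F x).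
{ intros x Hx.
  assert (E1 := Hsep x y1 Hx Hy1); assert (E2 := Hsep x y2 Hx Hy2).
  apply Rmult_eq_reg_l with (2 := Gy).
  transitivity (- F x * (k y1 * G y2 ^ 3 - k y2 * G y1 ^ 3)
                - F x ^ 3 * (m y1 * G y2 ^ 3 - m y2 * G y1 ^ 3)).
  - apply (f_equal (fun e => e * G y2 ^ 3)) in E1.
    apply (f_equal (fun e => e * G y1 ^ 3)) in E2.
    unfold D, k, m; lra.
  - unfold A, B; field; exact Gy. }
destruct (first_integral F x0 r A B) as [C HC]; [now auto|].
exists A, B, C; split; [now auto|].
assert (HUV : forall y, ball y0 r y ->
  Derive (Derive G) y = 2 * - C * G y ^ 3 + (4 - B) * G y /\
  2 * A * G y + B * G y ^ 3 + m y = 0).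
{ intros y Hy.
  set (U := Derive (Derive G) y + (B - 4) * G y + 2 * C * G y ^ 3).
  set (V := 2 * A * G y + B * G y ^ 3 + m y).
  assert (HU : forall x, ball x0 r x -> F x * (U + F x ^ 2 * V) = 0).
  { intros x Hx; assert (Eq := Hsep x y Hx Hy); unfold separated_equation in Eq.
    rewrite HF2, HC in Eq by exact Hx; unfold U, V, m; lra. }
  assert (HU1 := HU x1 Hx1); assert (HU2 := HU x2 Hx2).
  assert (HV0 : V = 0).
  { apply Rmult_eq_reg_l with (2 := Fx); rewrite Rmult_0_r.
    transitivity (F x1 * (F x2 * (U + F x2 ^ 2 * V))
                  - F x2 * (F x1 * (U + F x1 ^ 2 * V))); [ring|].
    rewrite HU1, HU2; ring. }
  split; [|exact HV0].
  rewrite HV0 in HU1.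
  assert (HU0 : U = 0).
  { apply Rmult_integral in HU1; destruct HU1 as [Z|Z]; [|lra].
    exfalso; apply Fx; rewrite Z; ring. }
  unfold U in HU0; lra. }
destruct (first_integral G y0 r (- C) (4 - B)) as [C' HC'].
{ intros y Hy; split; [now apply dG|]; apply (HUV y Hy). }
intros y Hy; rewrite (HC' y Hy).
(* At y1, V = 0 and the two equations for G give 2 (A + C') G = 0. *)
cut (C' = - A); [intros ->; ring|].
assert (HG1 : G y1 <> 0) by (intros Z; apply Gy; unfold D; rewrite Z; ring).
destruct (HUV y1 Hy1) as [EU EV]; unfold m in EV.
rewrite (HC' y1 Hy1), EU in EV.
apply Rmult_eq_reg_l with (2 := HG1); lra.
Qed.
(** * From the sinh-Gordon equation to the separated equation *)

Lemma exp_2_arctanh (u : R) :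
  Rabs u < 1 -> exp (2 * arctanh u) = (1 + u) / (1 - u).
Proof.
intros Hu; apply Rabs_def2 in Hu; unfold arctanh.
replace (2 * _) with (ln ((1 + u) / (1 - u))) by field.
apply exp_ln, Rdiv_lt_0_compat; lra.
Qed.

Lemma sinh_4_arctanh (u : R) :
  Rabs u < 1 ->
  sinh (2 * (2 * arctanh u)) = 4 * u * (1 + u ^ 2) / (1 - u ^ 2) ^ 2.
Proof.
intros Hu; assert (He := exp_2_arctanh u Hu); apply Rabs_def2 in Hu.
unfold sinh; rewrite exp_Ropp.
replace (2 * (2 * arctanh u)) with (2 * arctanh u + 2 * arctanh u) by ring.
rewrite exp_plus, He; field; repeat split; nra.
Qed.

(** Nothing is assumed on the regularity of F itself: solving v = 2 arctanh (F g)
    for F expresses it through exp v, and so F is as smooth as v. *)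
Lemma factor_twice_derivable (v F : R -> R) (g x0 r : R) :
  (forall x, ball x0 r x ->
     Rabs (F x * g) < 1 /\ v x = 2 * arctanh (F x * g) /\
     twice_derivable_at v x) ->
  g <> 0 -> forall x, ball x0 r x -> twice_derivable_at F x.
Proof.
intros Hv Hg.
set (F1 := fun x => 2 * Derive v x * exp (v x) / ((exp (v x) + 1) ^ 2 * g)).
assert (HF : forall x, ball x0 r x ->
  F x = (exp (v x) - 1) / ((exp (v x) + 1) * g)).
{ intros x Hx; destruct (Hv x Hx) as (Hu & -> & _).
  rewrite exp_2_arctanh by exact Hu; apply Rabs_def2 in Hu.
  field; repeat split; lra. }
assert (Hpos : forall x, exp (v x) + 1 <> 0).
{ intros x; generalize (exp_pos (v x)); lra. }
assert (HD : forall x, ball x0 r x -> is_derive F x (F1 x)).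
{ intros x Hx; destruct (Hv x Hx) as (_ & _ & d1 & d2).
  apply is_derive_ext_loc with (fun x => (exp (v x) - 1) / ((exp (v x) + 1) * g)).
  - generalize (ball_R_open _ _ _ Hx); apply filter_imp.
    intros t Ht; symmetry; now apply HF.
  - auto_derive.
    + repeat split; trivial.
      now apply Rmult_integral_contrapositive_currified.
    + change (Derive (fun x : R => v x) x) with (Derive v x).
      unfold F1; field; now split. }
intros x Hx; split; [eexists; now apply HD|].
apply ex_derive_ext_loc with F1.
- generalize (ball_R_open _ _ _ Hx); apply filter_imp.
  intros t Ht; symmetry; now apply is_derive_unique, HD.
- destruct (Hv x Hx) as (_ & _ & d1 & d2).
  unfold F1; auto_derive; repeat split; trivial.
  apply Rmult_integral_contrapositive_currified; [|exact Hg].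
  now repeat apply Rmult_integral_contrapositive_currified.
Qed.

Lemma second_derivative_of_slice (v F : R -> R) (g x0 r : R) :
  (forall x, ball x0 r x ->
     Rabs (F x * g) < 1 /\ v x = 2 * arctanh (F x * g) /\
     twice_derivable_at F x) ->
  forall x, ball x0 r x ->
  Derive_n v 2 x =
    2 * Derive (Derive F) x * g / (1 - (F x * g) ^ 2)
    + 4 * (F x * g) * (Derive F x * g) ^ 2 / (1 - (F x * g) ^ 2) ^ 2.
Proof.
intros Hv x Hx; change (Derive_n v 2 x) with (Derive (Derive v) x).
set (v1 := fun x => 2 * Derive F x * g / (1 - (F x * g) ^ 2)).
assert (HD : forall t, ball x0 r t -> Derive v t = v1 t).
{ intros t Ht; destruct (Hv t Ht) as (Hu & _ & d1 & _).
  apply Rabs_def2 in Hu; apply is_derive_unique.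
  apply is_derive_ext_loc with (fun x => 2 * arctanh (F x * g)).
  - generalize (ball_R_open _ _ _ Ht); apply filter_imp.
    intros s Hs; symmetry; apply (Hv s Hs).
  - unfold arctanh; auto_derive.
    + repeat split; trivial; [lra|].
      apply Rmult_lt_0_compat; [lra|apply Rinv_0_lt_compat; lra].
    + change (Derive (fun x : R => F x) t) with (Derive F t).
      unfold v1; field; repeat split; try lra; nra. }
rewrite (Derive_ext_loc _ v1).
- destruct (Hv x Hx) as (Hu & _ & d1 & d2).
  apply Rabs_def2 in Hu; apply is_derive_unique.
  unfold v1; auto_derive.
  + repeat split; trivial; nra.
  + change (Derive (fun x : R => F x) x) with (Derive F x).
    change (Derive (fun x : R => Derive (fun x0 : R => F x0) x) x)
      with (Derive (Derive F) x).
    change (Derive (fun x : R => Derive F x) x) with (Derive (Derive F) x).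
    field; nra.
- generalize (ball_R_open _ _ _ Hx); apply filter_imp; exact HD.
Qed.

Definition square_in (D : R * R -> Prop) (x0 y0 r : R) : Prop :=
  0 < r /\ forall x y, ball x0 r x -> ball y0 r y -> D (x, y).

(** The facts about the domain, F and G on which the global argument rests; they
    are invariant under the exchange of the two variables, which halves the
    work.  The non-vanishing assumptions are what makes the factors regular:
    where G vanishes on a whole side, the product says nothing about F. *)
Definition separates_on_squares (D : R * R -> Prop) (F G : R -> R) : Prop :=
  forall x0 y0 r, square_in D x0 y0 r ->
  (exists x, ball x0 r x /\ F x <> 0) ->
  (exists y, ball y0 r y /\ G y <> 0) ->
  (forall x, ball x0 r x -> twice_derivable_at F x) /\
  (forall y, ball y0 r y -> twice_derivable_at G y) /\
  (forall x y, ball x0 r x -> ball y0 r y ->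
     Rabs (F x * G y) < 1 /\
     separated_equation (F x) (Derive F x) (Derive (Derive F) x)
                        (G y) (Derive G y) (Derive (Derive G) y)).

Lemma sinh_Gordon_separates
  (D : R * R -> Prop) (F G : R -> R) (w : R -> R -> R) :
  (forall x y, D (x, y) -> Rabs (F x * G y) < 1) ->
  (forall x y, D (x, y) -> w x y = 2 * arctanh (F x * G y)) ->
  sinh_Gordon_solution D w ->
  separates_on_squares D F G.
Proof.
intros Hlt Hw [HC2 Hsol] x0 y0 r [_ Hsq] (x1 & Hx1 & F1) (y1 & Hy1 & G1).
assert (dF : forall x, ball x0 r x -> twice_derivable_at F x).
{ apply (factor_twice_derivable (fun x => w x y1) F (G y1)); [|exact G1].
  intros x Hx; assert (Ho := Hsq x y1 Hx Hy1).
  split; [now apply Hlt|split; [now apply Hw|]].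
  destruct (HC2 _ _ Ho) as (_ & d1 & _ & (_ & d2 & _) & _); now split. }
assert (dG : forall y, ball y0 r y -> twice_derivable_at G y).
{ apply (factor_twice_derivable (fun y => w x1 y) G (F x1)); [|exact F1].
  intros y Hy; assert (Ho := Hsq x1 y Hx1 Hy); rewrite (Rmult_comm (G y)).
  split; [now apply Hlt|split; [now apply Hw|]].
  destruct (HC2 _ _ Ho) as (_ & _ & d1 & _ & (_ & _ & d2 & _)); now split. }
split; [exact dF|split; [exact dG|]].
intros x y Hx Hy; assert (Ho := Hsq x y Hx Hy).
assert (Hu := Hlt x y Ho); split; [exact Hu|].
assert (Eq := Hsol x y Ho); unfold Laplacian in Eq.
rewrite (second_derivative_of_slice (fun t => w t y) F (G y) x0 r) in Eq;
  [|intros t Ht; split; [now apply Hlt, Hsq|split; [now apply Hw, Hsq|now apply dF]]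
   |exact Hx].
rewrite (second_derivative_of_slice (fun t => w x t) G (F x) y0 r) in Eq;
  [|intros t Ht; rewrite (Rmult_comm (G t));
    split; [now apply Hlt, Hsq|split; [now apply Hw, Hsq|now apply dG]]
   |exact Hy].
rewrite Hw, sinh_4_arctanh in Eq by assumption.
rewrite (Rmult_comm (G y) (F x)) in Eq.
assert (HD : 1 - (F x * G y) ^ 2 <> 0) by (apply Rabs_def2 in Hu; nra).
apply (f_equal (fun e => e * (1 - (F x * G y) ^ 2) ^ 2)) in Eq.
unfold separated_equation.
field_simplify in Eq; [|exact HD|exact HD].
field_simplify in Eq.
lra.
Qed.

(** * Propagation on connected domains *)

(** The retraction of the line on [0,1], used to extend paths to the whole
    line, where the intermediate value theorem is available. *)
Definition clamp (t : R) : R := Rmax 0 (Rmin 1 t).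

Lemma clamp_unit (t : R) : unit_interval (clamp t).
Proof.
unfold unit_interval, clamp, Rmax, Rmin.
destruct (Rle_dec 1 t); destruct (Rle_dec 0 _); lra.
Qed.

Lemma clamp_contracts (s t : R) : Rabs (clamp s - clamp t) <= Rabs (s - t).
Proof.
unfold clamp, Rmax, Rmin, Rabs.
destruct (Rle_dec 1 s); destruct (Rle_dec 1 t);
repeat destruct (Rle_dec 0 _); repeat destruct (Rcase_abs _); lra.
Qed.

(** Along a path the indicator function of S is locally constant, hence
    continuous, so it cannot jump from 1 to 0. *)
Lemma path_connected_clopen (D S : R * R -> Prop) :
  path_connected D ->
  (forall p, D p -> locally p (fun q => S q <-> S p)) ->
  forall p q, D p -> D q -> S p -> S q.
Proof.
intros Hpc HS p q Hp Hq Sp.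
destruct (Hpc p q Hp Hq) as (g & Hg & HgD & g0 & g1).
set (phi := fun t => if excluded_middle_informative
                          (S (g (clamp t))) then 1 else 0).
assert (Hphi : continuity phi).
{ intros t; apply continuity_pt_filterlim.
  assert (Hloc : locally t (fun s => phi s = phi t)).
  { destruct (Hg (clamp t) (clamp_unit t) _ (HS _ (HgD _ (clamp_unit t))))
      as [e He].
    exists e; intros s Hs; unfold phi.
    assert (Hst : S (g (clamp s)) <-> S (g (clamp t))).
    { apply He; [|apply clamp_unit].
      rewrite ball_R_iff in Hs |- *.
      apply Rle_lt_trans with (2 := Hs), clamp_contracts. }
    destruct (excluded_middle_informative _);
    destruct (excluded_middle_informative _); tauto. }
  apply (continuous_ext_loc phi (fun _ => phi t)).
  - revert Hloc; apply filter_imp; intros s Hs; now symmetry.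
  - apply continuous_const. }
assert (c0 : clamp 0 = 0) by (unfold clamp, Rmin, Rmax;
  destruct (Rle_dec 1 0); destruct (Rle_dec 0 _); lra).
assert (c1 : clamp 1 = 1) by (unfold clamp, Rmin, Rmax;
  destruct (Rle_dec 1 1); destruct (Rle_dec 0 _); lra).
apply Classical_Prop.NNPP; intros Sq.
destruct (IVT_gen phi 0 1 (1 / 2) Hphi) as [t [_ Ht]].
- unfold phi; rewrite c0, c1, g0, g1.
  destruct (excluded_middle_informative (S p)); [|tauto].
  destruct (excluded_middle_informative (S q)); [tauto|].
  unfold Rmin, Rmax; destruct (Rle_dec 1 0); lra.
- revert Ht; unfold phi.
  destruct (excluded_middle_informative _); lra.
Qed.

(** The form of analytic continuation used for all three global statements: if
    the validity of Z near one point of any square contained in D forces Z on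
    that square, then Z spreads from one point to all of D. *)
Lemma identity_principle (D Z : R * R -> Prop) :
  open D -> path_connected D ->
  (forall (p : R * R) (r : R), (forall q, ball p r q -> D q) ->
     forall q, ball p r q -> locally q Z -> forall z, ball p r z -> Z z) ->
  (exists p, D p /\ locally p Z) -> forall p, D p -> Z p.
Proof.
intros Hop Hpc Hprop (p0 & Hp0 & Zp0) p Hp.
apply (locally_singleton (T := prod_UniformSpace R_UniformSpace R_UniformSpace)).
apply (path_connected_clopen D (fun q => locally q Z)) with p0; trivial.
clear p p0 Hp0 Zp0 Hp; intros p Hp.
destruct (Hop p Hp) as [r Hr].
exists r; intros q Hq.
assert (Hup : forall a b, ball p r a -> ball p r b -> locally a Z -> locally b Z).
{ intros a b Ha Hb Za; generalize (ball_R2_open _ _ _ Hb); apply filter_imp.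
  now apply Hprop with a. }
assert (Hpp : ball p r p) by apply ball_center.
split; now apply Hup.
Qed.

(** * From squares to the whole domain *)

Lemma ball_R_center (x0 r : R) : 0 < r -> ball x0 r x0.
Proof. intros Hr; rewrite ball_R_iff, Rminus_eq_0, Rabs_R0; exact Hr. Qed.

Lemma ball_R_radius_pos (x0 r x : R) : ball x0 r x -> 0 < r.
Proof. rewrite ball_R_iff; apply Rle_lt_trans, Rabs_pos. Qed.

Lemma square_in_of_ball (D : R * R -> Prop) (p q : R * R) (r : R) :
  (forall z, ball p r z -> D z) -> ball p r q -> square_in D (fst p) (snd p) r.
Proof.
intros HD [Hq _]; split.
- now apply ball_R_radius_pos with (fst p) (fst q).
- intros x y Hx Hy; apply HD; now split.
Qed.

Lemma locally_fst (P : R -> Prop) (q : R * R) :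
  locally q (fun z => P (fst z)) -> locally (fst q) P.
Proof.
intros [e He]; exists e; intros x Hx.
apply (He (x, snd q)); split; [exact Hx|apply ball_center].
Qed.

Lemma locally_snd (P : R -> Prop) (q : R * R) :
  locally q (fun z => P (snd z)) -> locally (snd q) P.
Proof.
intros [e He]; exists e; intros y Hy.
apply (He (fst q, y)); split; [apply ball_center|exact Hy].
Qed.

Lemma locally_zero_product (F G : R -> R) (q : R * R) :
  locally q (fun z => F (fst z) * G (snd z) = 0) ->
  locally (fst q) (fun x => F x = 0) \/ locally (snd q) (fun y => G y = 0).
Proof.
intros [e He].
destruct (classic (exists x, ball (fst q) e x /\ F x <> 0))
  as [(x & Hx & Fx)|Hno].
- right; exists e; intros y Hy.
  assert (H : F x * G y = 0) by (apply (He (x, y)); now split).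
  apply Rmult_integral in H; tauto.
- left; exists e; intros x Hx.
  apply NNPP; intros Fx; apply Hno; now exists x.
Qed.

Lemma constant_near_constant_l
  (D : R * R -> Prop) (F G : R -> R) (x0 y0 r c q : R) :
  separates_on_squares D F G -> square_in D x0 y0 r ->
  (exists x, ball x0 r x /\ F x <> 0) ->
  (exists y, ball y0 r y /\ G y <> 0) ->
  ball x0 r q -> locally q (fun x => F x = c) ->
  forall x, ball x0 r x -> F x = c.
Proof.
intros Hsep Hsq HF HG Hq Hc.
destruct (Hsep x0 y0 r Hsq HF HG) as (dF & _ & Eq).
destruct HG as (y & Hy & Gy).
apply constant_near_constant with (3 := Hq) (4 := Hc) (2 := Gy)
  (g1 := Derive G y) (g2 := Derive (Derive G) y).
intros x Hx; split; [now apply dF|now apply Eq].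
Qed.

Lemma separates_on_squares_sym (D : R * R -> Prop) (F G : R -> R) :
  separates_on_squares D F G ->
  separates_on_squares (fun p => D (snd p, fst p)) G F.
Proof.
intros Hsep y0 x0 r [Hr Hsq] HG HF.
destruct (Hsep x0 y0 r) as (dF & dG & Eq); trivial.
{ split; [exact Hr|]; intros x y Hx Hy; now apply (Hsq y x). }
split; [exact dG|split; [exact dF|]].
intros y x Hy Hx; destruct (Eq x y Hx Hy) as [Hlt E].
rewrite Rmult_comm; split; [exact Hlt|now apply separated_equation_sym].
Qed.

Lemma square_in_sym (D : R * R -> Prop) (x0 y0 r : R) :
  square_in D x0 y0 r -> square_in (fun p => D (snd p, fst p)) y0 x0 r.
Proof. intros [Hr Hsq]; split; [exact Hr|]; intros y x Hy Hx; now apply Hsq. Qed.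

Lemma constant_near_constant_r
  (D : R * R -> Prop) (F G : R -> R) (x0 y0 r c q : R) :
  separates_on_squares D F G -> square_in D x0 y0 r ->
  (exists x, ball x0 r x /\ F x <> 0) ->
  (exists y, ball y0 r y /\ G y <> 0) ->
  ball y0 r q -> locally q (fun y => G y = c) ->
  forall y, ball y0 r y -> G y = c.
Proof.
intros Hsep Hsq HF HG.
now apply constant_near_constant_l
  with (1 := separates_on_squares_sym _ _ _ Hsep) (2 := square_in_sym _ _ _ _ Hsq).
Qed.

(** Unique continuation: if the product F G vanished on a square, one factor
    would vanish near some point of its side, hence on the side of any square
    of D around that point, and so the product would vanish on all of D. *)
Lemma factors_nonzero_on_squares (D : R * R -> Prop) (F G : R -> R) :
  open D -> path_connected D -> separates_on_squares D F G ->
  (exists x y, D (x, y) /\ F x * G y <> 0) ->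
  forall x0 y0 r, square_in D x0 y0 r ->
  (exists x, ball x0 r x /\ F x <> 0) /\ (exists y, ball y0 r y /\ G y <> 0).
Proof.
intros Hop Hpc Hsep (a & b & Hab & Hnz) x0 y0 r Hsq.
set (Z := fun z : R * R => F (fst z) * G (snd z) = 0).
assert (Hex : forall x y s, ~ (forall z, ball (x, y) s z -> Z z) ->
  (exists t, ball x s t /\ F t <> 0) /\ (exists t, ball y s t /\ G t <> 0)).
{ intros x y s Hno; split; apply NNPP; intros Hn; apply Hno;
  intros z [Hz1 Hz2]; apply Rmult_eq_0_compat.
  - left; apply NNPP; intros H; apply Hn; now exists (fst z).
  - right; apply NNPP; intros H; apply Hn; now exists (snd z). }
apply Hex; intros HZ; apply Hnz, (identity_principle D Z Hop Hpc) with (p := (a, b));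
  [|exists (x0, y0); split; [apply Hsq; apply ball_R_center, Hsq|]|exact Hab].
- clear x0 y0 r Hsq HZ; intros [x0 y0] r HD q Hq Zq; apply NNPP; intros Hno.
  assert (Hno' : ~ (forall z, ball (x0, y0) r z -> Z z)) by tauto.
  assert (Hsq := square_in_of_ball D _ _ _ HD Hq).
  destruct (Hex _ _ _ Hno') as [HF HG].
  destruct Hq as [Hq1 Hq2].
  apply locally_zero_product in Zq; destruct Zq as [Zq|Zq].
  + generalize (constant_near_constant_l D F G _ _ _ _ _ Hsep Hsq HF HG Hq1 Zq).
    destruct HF as (x & Hx & Fx); intros H; now apply Fx, H.
  + generalize (constant_near_constant_r D F G _ _ _ _ _ Hsep Hsq HF HG Hq2 Zq).
    destruct HG as (y & Hy & Gy); intros H; now apply Gy, H.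
- exists (mkposreal r (proj1 Hsq)); exact HZ.
Qed.

Lemma nonconstant_of_not_locally_constant (f : R -> R) (x0 r : R) :
  0 < r -> ~ (locally x0 (fun x => f x = f x0)) ->
  exists a b, ball x0 r a /\ ball x0 r b /\ f a <> f b.
Proof.
intros Hr Hno; apply NNPP; intros Hn; apply Hno.
exists (mkposreal r Hr); intros x Hx.
apply NNPP; intros H; apply Hn; exists x, x0; repeat split; trivial.
now apply ball_R_center.
Qed.

(** A factor that is constant on one side of a square keeps that value on every
    square met along a path, so it would be constant on its whole domain. *)
Lemma factors_nonconstant_on_squares (D : R * R -> Prop) (F G : R -> R) :
  open D -> path_connected D -> separates_on_squares D F G ->
  (exists x y, D (x, y) /\ F x * G y <> 0) ->
  non_constant_on (proj_x D) F -> non_constant_on (proj_y D) G ->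
  forall x0 y0 r, square_in D x0 y0 r ->
  (exists a b, ball x0 r a /\ ball x0 r b /\ F a <> F b) /\
  (exists a b, ball y0 r a /\ ball y0 r b /\ G a <> G b).
Proof.
intros Hop Hpc Hsep Hnz Fnc Gnc x0 y0 r [Hr Hsq].
assert (Hnv := factors_nonzero_on_squares D F G Hop Hpc Hsep Hnz).
assert (H0 : D (x0, y0)) by (apply Hsq; now apply ball_R_center).
split; apply nonconstant_of_not_locally_constant; trivial; intros Hloc.
- destruct Fnc as (a & b & (ya & Ha) & (yb & Hb) & Hab).
  assert (Hc : forall p, D p -> F (fst p) = F x0).
  { apply (identity_principle D (fun p => F (fst p) = F x0) Hop Hpc).
    - intros p s HD q Hq Zq z [Hz _].
      assert (Hs := square_in_of_ball D _ _ _ HD Hq).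
      destruct (Hnv _ _ _ Hs) as [HF HG].
      apply locally_fst with (P := fun x => F x = F x0) in Zq.
      now apply (constant_near_constant_l D F G _ _ _ _ _ Hsep Hs HF HG (proj1 Hq) Zq).
    - exists (x0, y0); split; [exact H0|].
      destruct Hloc as [e He]; exists e; intros z [Hz _]; now apply He. }
  apply Hab; rewrite (Hc _ Ha : F a = F x0); symmetry; exact (Hc _ Hb).
- destruct Gnc as (a & b & (xa & Ha) & (xb & Hb) & Hab).
  assert (Hc : forall p, D p -> G (snd p) = G y0).
  { apply (identity_principle D (fun p => G (snd p) = G y0) Hop Hpc).
    - intros p s HD q Hq Zq z [_ Hz].
      assert (Hs := square_in_of_ball D _ _ _ HD Hq).
      destruct (Hnv _ _ _ Hs) as [HF HG].
      apply locally_snd with (P := fun y => G y = G y0) in Zq.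
      now apply (constant_near_constant_r D F G _ _ _ _ _ Hsep Hs HF HG (proj2 Hq) Zq).
    - exists (x0, y0); split; [exact H0|].
      destruct Hloc as [e He]; exists e; intros z [_ Hz]; now apply He. }
  apply Hab; rewrite (Hc _ Ha : G a = G y0); symmetry; exact (Hc _ Hb).
Qed.

(** The second order equation for F is included because, unlike the first order
    one, it is linear in A and B alone and determines them from two values. *)
Definition quartic_equations_at (A B C : R) (F G : R -> R) (p : R * R) : Prop :=
  (ex_derive F (fst p) /\
   Derive (Derive F) (fst p) = 2 * A * F (fst p) ^ 3 + B * F (fst p) /\
   Derive F (fst p) ^ 2 = A * F (fst p) ^ 4 + B * F (fst p) ^ 2 + C) /\
  (ex_derive G (snd p) /\
   Derive G (snd p) ^ 2 = - C * G (snd p) ^ 4 - (B - 4) * G (snd p) ^ 2 - A).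

Lemma quartic_coefficients_unique
  (F G : R -> R) (A B C A' B' C' x1 x2 y1 y2 : R) :
  quartic_equations_at A B C F G (x1, y1) ->
  quartic_equations_at A' B' C' F G (x1, y1) ->
  quartic_equations_at A B C F G (x2, y2) ->
  quartic_equations_at A' B' C' F G (x2, y2) ->
  F x1 * F x2 * (F x2 ^ 2 - F x1 ^ 2) <> 0 ->
  A = A' /\ B = B' /\ C = C'.
Proof.
intros [(_ & E1 & C1) _] [(_ & E1' & C1') _] [(_ & E2 & _) _] [(_ & E2' & _) _] Hd.
simpl fst in *.
rewrite E1 in E1'; rewrite E2 in E2'; rewrite C1 in C1'.
set (f := F x1) in *; set (h := F x2) in *.
assert (HA : A = A').
{ apply Rmult_eq_reg_l with (2 := Hd).
  apply (f_equal (fun e => e * h)) in E1'; apply (f_equal (fun e => e * f)) in E2'.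
  lra. }
subst A'.
assert (HB : B = B').
{ apply Rmult_eq_reg_l with f; [lra|intros Z; apply Hd; rewrite Z; ring]. }
subst B'; repeat split; lra.
Qed.

Theorem proposition12
  (Omega : R * R -> Prop) (F G : R -> R) (w : R -> R -> R)
  (Omega_open : open Omega)
  (Omega_sc : simply_connected Omega)
  (F_nc : non_constant_on (proj_x Omega) F)
  (G_nc : non_constant_on (proj_y Omega) G)
  (FG_lt1 : forall x y, Omega (x, y) -> Rabs (F x * G y) < 1)
  (w_def : forall x y, Omega (x, y) -> w x y = 2 * arctanh (F x * G y))
  (w_nz : exists x y, Omega (x, y) /\ w x y <> 0)
  (w_sol : sinh_Gordon_solution Omega w) :
  exists A B C : R,
    (forall x, proj_x Omega x ->
       ex_derive F x /\
       (Derive F x) ^ 2 = A * F x ^ 4 + B * F x ^ 2 + C) /\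
    (forall y, proj_y Omega y ->
       ex_derive G y /\
       (Derive G y) ^ 2 = - C * G y ^ 4 - (B - 4) * G y ^ 2 - A).
Proof.
destruct Omega_sc as [Hpc _].
assert (Hsep := sinh_Gordon_separates Omega F G w FG_lt1 w_def w_sol).
assert (Hnz : exists x y, Omega (x, y) /\ F x * G y <> 0).
{ destruct w_nz as (x & y & Ho & Hw); exists x, y; split; [exact Ho|].
  intros Z; apply Hw; rewrite w_def, Z by exact Ho; unfold arctanh.
  replace ((1 + 0) / (1 - 0)) with 1 by field; rewrite ln_1; ring. }
assert (Hnv := factors_nonzero_on_squares Omega F G Omega_open Hpc Hsep Hnz).
assert (Hnc := factors_nonconstant_on_squares Omega F G Omega_open Hpc Hsep Hnz F_nc G_nc).
assert (Hloc : forall x0 y0 r, square_in Omega x0 y0 r ->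
  exists A B C, forall z, ball (x0, y0) r z -> quartic_equations_at A B C F G z).
{ intros x0 y0 r Hsq.
  destruct (Hnv _ _ _ Hsq) as [HF HG]; destruct (Hnc _ _ _ Hsq) as [HFn HGn].
  destruct (Hsep _ _ _ Hsq HF HG) as (dF & dG & Eq).
  destruct (local_quartic_equations F G x0 y0 r) as (A & B & C & H1 & H2); trivial.
  { intros x y Hx Hy; now apply Eq. }
  exists A, B, C; intros z [Hz1 Hz2]; split; split.
  - now apply dF.
  - now apply H1.
  - now apply dG.
  - now apply H2. }
assert (Hstart : exists A B C p, Omega p /\ locally p (quartic_equations_at A B C F G)).
{ destruct Hnz as (x & y & Ho & _).
  destruct (Omega_open _ Ho) as [r Hr].
  assert (Hsq := square_in_of_ball Omega _ _ _ Hr (ball_center (x, y) r)).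
  destruct (Hloc _ _ _ Hsq) as (A & B & C & H).
  exists A, B, C, (x, y); split; [exact Ho|]; exists r; exact H. }
destruct Hstart as (A & B & C & Hp).
assert (Hall : forall p, Omega p -> quartic_equations_at A B C F G p).
{ apply (identity_principle Omega _ Omega_open Hpc); [|exact Hp].
  clear Hp; intros p r HD q Hq Zq.
  assert (Hsq := square_in_of_ball Omega _ _ _ HD Hq).
  destruct (Hloc _ _ _ Hsq) as (A' & B' & C' & H'); rewrite <- surjective_pairing in H'.
  destruct (filter_and _ _ Zq (ball_R2_open _ _ _ Hq)) as [e He].
  assert (Hsq' : square_in Omega (fst q) (snd q) e).
  { split; [apply cond_pos|]; intros x y Hx Hy.
    apply HD, (He (x, y)); now split. }
  destruct (Hnc _ _ _ Hsq') as [(a & b & Ha & Hb & Fab) _].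
  assert (Hy : ball (snd q) e (snd q)) by apply ball_center.
  destruct (two_distinct_squares F (fst q) e a b) as (x1 & x2 & Hx1 & Hx2 & Hd);
    trivial.
  { intros x Hx; now apply (He (x, snd q)). }
  destruct (He (x1, snd q)) as [E1 B1]; [now split|].
  destruct (He (x2, snd q)) as [E2 B2]; [now split|].
  destruct (quartic_coefficients_unique F G A B C A' B' C' x1 x2 (snd q) (snd q))
    as (-> & -> & ->); auto. }
exists A, B, C; split.
- intros x [y Ho]; destruct (Hall _ Ho) as [(H1 & _ & H2) _]; now split.
- intros y [x Ho]; exact (proj2 (Hall _ Ho)).
Qed.
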